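(* Let $n\ge 2$, let $\boldsymbol{X}$ be a nonnegative $n$-dimensional random vector with mean vector $\boldsymbol{\mu}=(\mu_1,\ldots,\mu_n)^\top$ and positive definite covariance matrix $\boldsymbol{\Sigma}$, and let $G=(V,E)$ be a connected simple undirected graph with $V=\{1,\ldots,n\}$, graph Laplacian $\boldsymbol{L}$, and complementary edge set $\overline{E}$. The optimization problem over $\boldsymbol{A}=(a_{ij})\in\mathbb{R}^{n\times n}$ $$ \begin{cases} \text{minimize} & \frac{1}{2}\operatorname{tr}(\boldsymbol{A}\boldsymbol{\Sigma}\boldsymbol{A}^\top)\\ \text{subject to} & \boldsymbol{1}^\top\boldsymbol{A}=\boldsymbol{1}^\top,\quad \boldsymbol{A}\boldsymbol{\mu}=\boldsymbol{\mu},\quad a_{ij}=0\text{ whenever }\{i,j\}\in\overline{E},\\ & a_{i_1j}=a_{i_2j},\quad \forall\,\{i_1,j\},\{i_2,j\}\in E \end{cases} $$ has a unique solution $$ \hat{\boldsymbol{A}}=\boldsymbol{I}-\hat{c}\,\boldsymbol{L}\boldsymbol{M}^{-1},\quad\text{for}\quad \hat{c}=\frac{\operatorname{tr}\left(\boldsymbol{\Sigma}\boldsymbol{L}\boldsymbol{M}^{-1}\right)}{\operatorname{tr}\left(\boldsymbol{L}\boldsymbol{M}^{-1}\boldsymbol{\Sigma}\boldsymbol{M}^{-1}\boldsymbol{L}\right)}, $$ where $\boldsymbol{M}=\operatorname{diag}(\mu_1,\ldots,\mu_n)$.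
   Context: $\boldsymbol{1}$ is the $n$-dimensional column vector of ones and $\boldsymbol{I}$ the $n\times n$ identity matrix. $\boldsymbol{\mu}=\mathbb{E}[\boldsymbol{X}]$ and $\boldsymbol{\Sigma}=\mathbb{E}[(\boldsymbol{X}-\boldsymbol{\mu})(\boldsymbol{X}-\boldsymbol{\mu})^\top]$. Since $\boldsymbol{X}$ is entrywise nonnegative and $\boldsymbol{\Sigma}$ is positive definite, all $\mu_i>0$, so $\boldsymbol{M}$ is invertible. $E$ is a set of unordered pairs of distinct vertices, and $\overline{E}=\{\{i,j\}: i,j\in V,\ i\neq j,\ \{i,j\}\notin E\}$. The graph Laplacian is $\boldsymbol{L}=\boldsymbol{D}-\boldsymbol{W}$, where $\boldsymbol{W}$ is the adjacency matrix ($w_{ij}=1$ if $\{i,j\}\in E$ and $0$ otherwise) and $\boldsymbol{D}=\operatorname{diag}(d_1,\ldots,d_n)$ with $d_i$ the degree of vertex $i$. The denominator defining $\hat{c}$ is strictly positive in this setting. *)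

(* Defs.v *)
From HB Require Import structures.
From mathcomp Require Import all_boot all_order all_algebra.
From mathcomp Require Import all_classical all_reals all_analysis.
Set Implicit Arguments.
Unset Strict Implicit.
Unset Printing Implicit Defensive.
Import Order.TTheory GRing.Theory Num.Theory.
Local Open Scope ring_scope.

Section Graph.
Variable n : nat.
Implicit Types E : {set {set 'I_n}}.

(* A simple undirected graph on 'I_n is given by its set of edges, which are
   unordered pairs of distinct vertices. *)
Definition simple_graph E := forall e, e \in E -> #|e| = 2%N.

Definition adj E : rel 'I_n := fun i j => [set i; j]%SET \in E.

Definition connected_graph E := forall i j, connect (adj E) i j.

Definition co_edges E : {set {set 'I_n}} :=
  [set [set p.1; p.2]%SET | p : 'I_n * 'I_n
    & (p.1 != p.2) && ~~ adj E p.1 p.2]%SET.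

Definition degree E (i : 'I_n) : nat := #|[set j | adj E i j]%SET|.

Definition adjacency_mx (R : pzRingType) E : 'M[R]_n :=
  \matrix_(i, j) (adj E i j)%:R.

Definition laplacian (R : pzRingType) E : 'M[R]_n :=
  diag_mx (\row_i (degree E i)%:R) - adjacency_mx R E.

End Graph.

Definition posdefmx (R : numDomainType) (n : nat) (S : 'M[R]_n) :=
  S^T = S /\ forall x : 'cV[R]_n, x != 0 -> 0 < (x^T *m S *m x) 0 0.

Section RandomVector.
Context (d : measure_display) (T : measurableType d) (R : realType).
Variables (P : probability T R) (n : nat).

(* The coercion [fine] from \bar R is only meaningful when the moments are
   finite, e.g. for square-integrable entries. *)
Definition mean_vector (X : 'I_n -> {RV P >-> R}) : 'cV[R]_n :=
  \col_i fine ('E_P[X i])%E.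

Definition covariance_mx (X : 'I_n -> {RV P >-> R}) : 'M[R]_n :=
  \matrix_(i, j) fine (covariance P (X i) (X j)).

End RandomVector.

Section Problem.
Variables (R : realFieldType) (n : nat).

Definition feasible (E : {set {set 'I_n}}) (mu : 'cV[R]_n) (A : 'M[R]_n) :=
  [/\ const_mx 1 *m A = const_mx 1 :> 'rV[R]_n,
      A *m mu = mu,
      forall i j, [set i; j]%SET \in co_edges E -> A i j = 0
    & forall i1 i2 j, [set i1; j]%SET \in E -> [set i2; j]%SET \in E ->
        A i1 j = A i2 j].

Definition objective (Sigma A : 'M[R]_n) : R :=
  2^-1 * \tr (A *m Sigma *m A^T).

Definition solution E mu (Sigma A : 'M[R]_n) :=
  feasible E mu A /\
  forall B, feasible E mu B -> objective Sigma A <= objective Sigma B.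

Definition c_hat (L M Sigma : 'M[R]_n) : R :=
  \tr (Sigma *m L *m invmx M)
    / \tr (L *m invmx M *m Sigma *m invmx M *m L).

End Problem.

(* Main.v *)
Require Import Defs.
From HB Require Import structures.
From mathcomp Require Import all_boot all_order all_algebra.
From mathcomp Require Import all_classical all_reals all_analysis.
From mathcomp Require Import measurable_realfun ring.
Set Implicit Arguments.
Unset Strict Implicit.
Unset Printing Implicit Defensive.
Import Order.TTheory GRing.Theory Num.Theory.
Local Open Scope ring_scope.

(** The constraints leave a single degree of freedom. The edge condition says
    that the off-diagonal entries of a column j of A share one value b_j on the
    neighbours of j and vanish elsewhere; the column sums then force the
    diagonal, so A = I - L diag(b) ([feasible_diag]). Now A mu = mu reads
    L diag(b) mu = 0, and the kernel of the Laplacian of a connected graph is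
    spanned by the vector of ones ([laplacian_ker]), so b_j mu_j is a
    constant c and A = I - c N with N = L M^-1 ([feasible_eq_line]).
    Conversely all these matrices are feasible ([feasible_line]).

    On this line the objective is a quadratic polynomial in c with leading
    coefficient tr(N Sigma N^T) / 2, which is positive because Sigma is positive
    definite and N is nonzero. Its vertex is the constant c_hat, and completing
    the square ([objective_gap]) shows that the vertex is the only minimizer.

    Inverting M needs nonzero means. A nonnegative variable of mean zero vanishes
    almost surely and so has variance zero, which positive definiteness of the
    covariance matrix excludes ([expectation_gt0_of_variance_gt0]). *)

(** * Positivity of the means *)

(** If the mean were at most 0, the integral of |Y| would be 0, so Y = 0 almost
    surely and the variance would be an integral of an almost surely zero
    function. *)
Lemma expectation_gt0_of_variance_gt0 (d : measure_display)
    (T : measurableType d) (R : realType) (P : probability T R) (Y : {RV P >-> R}) :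
  (Y : T -> R) \in Lfun P 2%:E ->
  {ae P, forall w, 0 <= Y w} ->
  0 < fine (covariance P Y Y) ->
  0 < fine ('E_P[Y])%E.
Proof.
move=> Y2 Y0; apply: contraTT; rewrite -!leNgt => EY_le0.
have Y1 : (Y : T -> R) \in Lfun P 1.
  by apply: Lfun_subset12 => //; exact: fin_num_measure.
have mY : measurable_fun [set: T]%classic (EFin \o Y) by exact/measurable_EFinP.
have EYabs : ('E_P[Y] = \int[P]_w `|(Y w)%:E|)%E.
  rewrite expectation_def; apply: ae_eq_integral => //.
    exact: measurableT_comp.
  by apply: filterS Y0 => w Yw _ /=; rewrite ger0_norm.
have EY0 : ('E_P[Y] = 0)%E.
  apply/eqP; rewrite eq_le; apply/andP; split.
    by rewrite -(fineK (expectation_fin_num Y1)) lee_fin.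
  by rewrite EYabs; apply: integral_ge0 => w _; exact: abse_ge0.
have Yae0 : ae_eq P [set: T]%classic (EFin \o Y) (cst 0%E).
  by apply/ae_eq_integral_abs => //; rewrite -[LHS]EYabs.
suff -> : covariance P Y Y = 0%E by [].
rewrite unlock EY0 unlock -[RHS](integral0 P [set: T]%classic).
apply: ae_eq_integral => //.
  apply/measurable_EFinP; apply: measurable_funM; exact: measurable_funB.
apply: filterS Yae0 => w /(_ I) /= [Yw] _.
by rewrite -[X in X%:E]/((Y w - 0) * (Y w - 0)) Yw subrr mulr0.
Qed.

(** * The Laplacian and its kernel *)

Section LaplacianTheory.
Variables (R : realFieldType) (n : nat) (E : {set {set 'I_n}}).
Local Notation L := (laplacian R E).

Lemma adj_sym : symmetric (adj E).
Proof. by move=> i j; rewrite /adj finset.setUC. Qed.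

Lemma laplacianE i j :
  L i j = (degree E i)%:R *+ (i == j) - (adj E i j)%:R.
Proof. by rewrite !mxE. Qed.

Lemma natr_degree i : (degree E i)%:R = \sum_j (adj E i j)%:R :> R.
Proof.
rewrite -natr_sum /degree -sum1dep_card; congr _%:R.
by rewrite big_mkcond; apply: eq_bigr => j _; case: ifP.
Qed.

Lemma laplacian_tr : L^T = L.
Proof.
apply/matrixP=> i j; rewrite mxE !laplacianE adj_sym eq_sym.
by case: eqVneq => // ->.
Qed.

Lemma laplacian_mulcv (v : 'cV[R]_n) i :
  (L *m v) i 0 = \sum_j (adj E i j)%:R * (v i 0 - v j 0).
Proof.
rewrite mxE.
under eq_bigr do rewrite laplacianE mulrBl.
rewrite sumrB (bigD1 i) //= eqxx mulr1n big1 ?addr0; last first.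
  by move=> j /negPf ij; rewrite eq_sym ij mul0r.
rewrite natr_degree mulr_suml -sumrB.
by apply: eq_bigr => j _; rewrite mulrBr.
Qed.

Lemma laplacian_const : L *m const_mx 1 = 0 :> 'cV_n.
Proof.
apply/matrixP=> i j; rewrite ord1 laplacian_mulcv big1 ?mxE // => k _.
by rewrite !mxE subrr mulr0.
Qed.

Lemma const_laplacian : const_mx 1 *m L = 0 :> 'rV_n.
Proof.
rewrite -[L]laplacian_tr -[const_mx 1]trmx_const -trmx_mul.
by rewrite laplacian_const trmx0.
Qed.

(** The Dirichlet form of the graph; every edge occurs twice in the double sum
    over ordered pairs, hence the factor 2 on the left. *)
Lemma laplacian_form (v : 'cV[R]_n) :
  (v^T *m (L *m v)) 0 0 *+ 2 =
  \sum_i \sum_j (adj E i j)%:R * (v i 0 - v j 0) ^+ 2.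
Proof.
have quad : (v^T *m (L *m v)) 0 0 =
    \sum_i \sum_j (adj E i j)%:R * (v i 0 * (v i 0 - v j 0)).
  rewrite mxE; apply: eq_bigr => i _; rewrite laplacian_mulcv mxE mulr_sumr.
  by apply: eq_bigr => j _; rewrite mulrCA.
rewrite mulr2n {1}quad quad [X in _ + X]exchange_big -big_split.
apply: eq_bigr => i _; rewrite -big_split; apply: eq_bigr => j _ /=.
by rewrite (adj_sym j i); ring.
Qed.

(** When L v = 0 the Dirichlet form at v is 0; it is a sum of squares, so v takes
    equal values at the ends of every edge, hence along every path. *)
Lemma laplacian_ker (v : 'cV[R]_n) :
  connected_graph E -> L *m v = 0 -> forall i j, v i 0 = v j 0.
Proof.
move=> Econn Lv0.
have eq_adj i j : adj E i j -> v i 0 = v j 0.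
  move=> ij; have := laplacian_form v; rewrite Lv0 mulmx0 mxE mul0rn.
  have sq_ge0 k l : 0 <= (adj E k l)%:R * (v k 0 - v l 0) ^+ 2.
    by rewrite mulr_ge0 ?ler0n ?sqr_ge0.
  move/esym/eqP; rewrite psumr_eq0 => [|k _]; last exact: sumr_ge0.
  move/allP/(_ i (mem_index_enum i)) => /=.
  rewrite psumr_eq0 // => /allP/(_ j (mem_index_enum j)) /=.
  by rewrite ij mul1r sqrf_eq0 subr_eq0 => /eqP.
move=> i j; have /connectP[p] := Econn i j.
elim: p i => [|k p IHp] i /= => [_ -> //|/andP[/eq_adj -> kp] jp].
exact: IHp.
Qed.

(** Used to read off the common value of each column of a feasible matrix, and
    to see that the Laplacian is not zero. *)
Lemma neighbor_exists :
  (2 <= n)%N -> connected_graph E -> forall j, exists i, adj E i j.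
Proof.
move=> n2 Econn j.
have /existsP[k kj] : [exists k, k != j].
  apply: contraT; rewrite negb_exists => /forallP all_j.
  have : #|'I_n| = 1%N.
    rewrite -(card1 j); apply: eq_card => k.
    by rewrite !inE; move/negbNE: (all_j k) => ->.
  by rewrite card_ord => n1; rewrite n1 in n2.
have /connectP[[|i p] /= ] := Econn j k.
  by move=> _ jk; rewrite jk eqxx in kj.
by case/andP=> ji _ _; exists i; rewrite adj_sym.
Qed.

Hypothesis Esimple : simple_graph E.

Lemma adj_irr i : adj E i i = false.
Proof. by apply/negP => /Esimple; rewrite finset.setUid cards1. Qed.

Lemma in_co_edges i j :
  ([set i; j]%SET \in co_edges E) = (i != j) && ~~ adj E i j.
Proof.
apply/imsetP/idP => [[[k l]]|ij]; last by exists (i, j); rewrite ?inE.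
rewrite inE /= => /andP[kl nkl] ijkl.
rewrite /adj ijkl nkl andbT; apply: contra_neqN kl => /eqP ij.
move: ijkl; rewrite ij finset.setUid => /esym/finset.setP ijkl.
have := ijkl k; have := ijkl l.
by rewrite !inE !eqxx orbT => /esym/eqP -> /esym/eqP ->.
Qed.

(** * The feasible set is a line *)

Section Feasible.
Variable mu : 'cV[R]_n.
Hypothesis mu_neq0 : forall i, mu i 0 != 0.
Let M := diag_mx mu^T.

Lemma diag_unitmx : M \in unitmx.
Proof.
by rewrite unitmxE det_diag unitfE; apply/prodf_neq0 => i _; rewrite mxE.
Qed.

Lemma invmx_diag : invmx M = diag_mx (\row_i (mu i 0)^-1).
Proof.
rewrite -[RHS](mulKmx diag_unitmx) -[LHS]mulmx1; congr (_ *m _).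
apply/matrixP=> i j; rewrite /M mul_diag_mx !mxE.
by case: eqVneq => [->|]; rewrite ?mulr0 // !mulr1n divff.
Qed.

Lemma laplacian_invmxE i j : (L *m invmx M) i j = L i j / mu j 0.
Proof. by rewrite invmx_diag mul_mx_diag !mxE. Qed.

Lemma laplacian_invmx_neq0 :
  (2 <= n)%N -> connected_graph E -> L *m invmx M != 0.
Proof.
move=> n2 Econn; pose j : 'I_n := Ordinal (ltnW n2).
have [i ij] := neighbor_exists n2 Econn j.
apply/eqP => /matrixP/(_ i j)/eqP.
rewrite laplacian_invmxE laplacianE ij mxE.
have /negPf-> : i != j by apply: contraTneq ij => ->; rewrite adj_irr.
by rewrite mulr0n sub0r mulN1r oppr_eq0 invr_eq0 (negPf (mu_neq0 j)).
Qed.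

(** The four constraints hold, in order, because the columns of L sum to 0,
    because M^-1 mu is the vector of ones, which L annihilates, because L is 0 at
    non-adjacent pairs, and because column j of L M^-1 is constantly - 1 / mu_j on
    the neighbours of j. *)
Lemma feasible_line c : feasible E mu (1%:M - c *: (L *m invmx M)).
Proof.
have AE i j : (1%:M - c *: (L *m invmx M)) i j =
    (i == j)%:R - c * (L i j * (mu j 0)^-1).
  by rewrite -laplacian_invmxE !mxE.
have AadjE i j : adj E i j ->
    (1%:M - c *: (L *m invmx M)) i j = c * (mu j 0)^-1.
  move=> ij; rewrite AE laplacianE ij.
  have /negPf-> : i != j by apply: contraTneq ij => ->; rewrite adj_irr.
  by rewrite mulr0n !sub0r mulN1r mulrN opprK.
split=> [||i j|i1 i2 j]; last by move=> /AadjE -> /AadjE ->.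
- by rewrite mulmxBr mulmx1 -scalemxAr mulmxA const_laplacian mul0mx scaler0 subr0.
- have -> : mu = M *m const_mx 1.
    by apply/matrixP=> i j; rewrite /M mul_diag_mx !mxE ord1 mulr1.
  rewrite mulmxBl mul1mx -scalemxAl -mulmxA mulKmx ?diag_unitmx //.
  by rewrite laplacian_const scaler0 subr0.
- rewrite in_co_edges => /andP[/negPf ij /negPf nij].
  by rewrite AE laplacianE ij nij mulr0n subrr mul0r mulr0 subrr.
Qed.

(** b_j is the entry of column j at any chosen neighbour of j; the diagonal entry
    1 - d_j b_j then comes from the column sum, the degree d_j counting the
    neighbours. *)
Lemma feasible_diag (A : 'M[R]_n) :
  (2 <= n)%N -> connected_graph E -> feasible E mu A ->
  exists b : 'rV[R]_n, A = 1%:M - L *m diag_mx b.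
Proof.
move=> n2 Econn [oneA _ A0 Acol].
have nbP j := xchooseP (neighbor_exists n2 Econn j).
pose b := \row_j A (xchoose (neighbor_exists n2 Econn j)) j.
have Aadj i j : adj E i j -> A i j = b 0 j.
  by move=> ij; rewrite mxE; apply: Acol => //; exact: nbP.
have Aoff i j : i != j -> A i j = (adj E i j)%:R * b 0 j.
  move=> ij; have [/Aadj -> |nij] := boolP (adj E i j); first by rewrite mul1r.
  by rewrite mul0r A0 // in_co_edges ij.
exists b; apply/matrixP=> i j.
have -> : (1%:M - L *m diag_mx b) i j = (i == j)%:R - L i j * b 0 j.
  by rewrite mul_mx_diag !mxE.
rewrite laplacianE; have [->|ij] := eqVneq i j; last first.
  by rewrite Aoff // mulr0n !sub0r mulNr opprK.
rewrite adj_irr mulr1n subr0.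
move/matrixP/(_ 0 j): oneA; rewrite !mxE (bigD1 j) //= mxE mul1r.
rewrite (eq_bigr (fun i => (adj E j i)%:R * b 0 j)) => [|k kj]; last first.
  by rewrite mxE mul1r Aoff // adj_sym.
move=> /(canRL (addrK _)) ->; congr (_ - _).
rewrite natr_degree mulr_suml [RHS](bigD1 j) //= adj_irr mul0r add0r.
by apply: eq_bigr => k _; rewrite [b 0 j]mxE.
Qed.

(** Since L diag(b) mu = 0, the products b_j mu_j have a common value, which is
    the parameter c. *)
Lemma feasible_eq_line (A : 'M[R]_n) :
  (2 <= n)%N -> connected_graph E -> feasible E mu A ->
  exists c, A = 1%:M - c *: (L *m invmx M).
Proof.
move=> n2 Econn Afeas; have [b AE] := feasible_diag n2 Econn Afeas.
case: Afeas => _ Amu _ _.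
have Lbmu : L *m (diag_mx b *m mu) = 0.
  move: Amu; rewrite AE mulmxBl mul1mx -mulmxA => /eqP.
  by rewrite subr_eq addrC -subr_eq subrr => /eqP <-.
pose i0 : 'I_n := Ordinal (ltnW n2).
exists (b 0 i0 * mu i0 0); rewrite AE; congr (_ - _).
rewrite scalemxAr; congr (_ *m _); rewrite invmx_diag.
apply/matrixP=> i j; rewrite !mxE mulrnAr; congr (_ *+ _).
have := laplacian_ker Econn Lbmu i0 i; rewrite !mul_diag_mx !mxE => ->.
by rewrite mulfK.
Qed.

End Feasible.
End LaplacianTheory.

(** * The objective along a line through the identity *)

Section Quadratic.
Variables (R : realFieldType) (n : nat) (Sigma : 'M[R]_n).
Hypothesis Sigma_pd : posdefmx Sigma.

(** The trace sums the values of the quadratic form of Sigma at the rows of N,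
    one of which is nonzero. *)
Lemma trace_form_gt0 (N : 'M[R]_n) : N != 0 -> 0 < \tr (N *m Sigma *m N^T).
Proof.
case: Sigma_pd => _ pd N0.
have diagE i : (N *m Sigma *m N^T) i i =
    (((row i N)^T)^T *m Sigma *m (row i N)^T) 0 0.
  by rewrite trmxK -row_mul [RHS]mxE [LHS]mxE; apply: eq_bigr => k _; rewrite !mxE.
have diag_ge0 i : 0 <= (N *m Sigma *m N^T) i i.
  rewrite diagE; have [->|r0] := eqVneq (row i N) 0; last first.
    by apply/ltW/pd; rewrite trmx_eq0.
  by rewrite trmx0 mulmx0 mxE.
have [i ri] : exists i, row i N != 0.
  apply/existsP; apply: contraNT N0; rewrite negb_exists => /forallP rows0.
  by apply/eqP/row_matrixP => i; rewrite row0; apply/eqP/negbNE.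
rewrite /mxtrace (bigD1 i) //= ltr_pwDl ?sumr_ge0 //.
by rewrite diagE pd // trmx_eq0.
Qed.

Lemma objective_line (N : 'M[R]_n) c :
  objective Sigma (1%:M - c *: N) =
  2^-1 * (\tr Sigma - 2 * c * \tr (Sigma *m N)
          + c ^+ 2 * \tr (N *m Sigma *m N^T)).
Proof.
case: Sigma_pd => symS _; rewrite /objective; congr (_ * _).
have -> : (1%:M - c *: N)^T = 1%:M - c *: N^T.
  by rewrite linearB linearZ /= trmx1.
rewrite mulmxBl mul1mx mulmxBr !mulmxBl mulmx1 -!scalemxAr -!scalemxAl.
rewrite !linearB !linearZ /= mulmx1 (mxtrace_mulC N).
have -> : \tr (Sigma *m N^T) = \tr (Sigma *m N).
  by rewrite -[LHS]mxtrace_tr trmx_mul trmxK symS mxtrace_mulC.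
by ring.
Qed.

(** The hypothesis says that the derivative of the objective vanishes at c0;
    writing it as a product avoids any division. *)
Lemma objective_gap (N : 'M[R]_n) c0 c :
  c0 * \tr (N *m Sigma *m N^T) = \tr (Sigma *m N) ->
  objective Sigma (1%:M - c *: N) - objective Sigma (1%:M - c0 *: N) =
  2^-1 * \tr (N *m Sigma *m N^T) * (c - c0) ^+ 2.
Proof. by move=> c0E; rewrite !objective_line -c0E; ring. Qed.

End Quadratic.

(** * The optimal matrix *)

Theorem theorem2p2 (d : measure_display) (T : measurableType d) (R : realType)
    (P : probability T R) (n : nat) (X : 'I_n -> {RV P >-> R})
    (E : {set {set 'I_n}}) :
  (2 <= n)%N ->
  (forall i, (X i : T -> R) \in Lfun P 2%:E) ->
  (forall i, {ae P, forall w, 0 <= X i w}) ->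
  posdefmx (covariance_mx X) ->
  simple_graph E ->
  connected_graph E ->
  let mu := mean_vector X in
  let Sigma := covariance_mx X in
  let L := laplacian R E in
  let M := diag_mx mu^T in
  unique (solution E mu Sigma) (1%:M - c_hat L M Sigma *: (L *m invmx M)).
Proof.
move=> n2 X2 X0 pdS Es Ec mu Sigma L M.
have mu_neq0 i : mu i 0 != 0.
  rewrite mxE gt_eqF // expectation_gt0_of_variance_gt0 //.
  (* The form at the i-th basis vector is the variance of X i. *)
  case: pdS => _ /(_ (delta_mx i 0)).
  rewrite trmx_delta -rowE -colE !mxE; apply.
  by apply/eqP => /matrixP/(_ i 0)/eqP; rewrite !mxE !eqxx oner_eq0.
set N := L *m invmx M.
have N_neq0 : N != 0 by exact: laplacian_invmx_neq0.
have D_gt0 := trace_form_gt0 pdS N_neq0.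
have c_hatE : c_hat L M Sigma * \tr (N *m Sigma *m N^T) = \tr (Sigma *m N).
  (* The denominator of c_hat is written with M^-1 L, which is N^T. *)
  have NtrE : N^T = invmx M *m L.
    by rewrite trmx_mul laplacian_tr trmx_inv tr_diag_mx.
  by rewrite /c_hat -!mulmxA -NtrE !mulmxA -/N mulfVK ?gt_eqF.
have gap c := objective_gap pdS c c_hatE.
split=> [|B [/(feasible_eq_line Es mu_neq0 n2 Ec)[c ->] Bmin]].
  split=> [|B /(feasible_eq_line Es mu_neq0 n2 Ec)[c ->]].
    exact: feasible_line.
  by rewrite -subr_ge0 gap mulr_ge0 ?sqr_ge0 // ltW // mulr_gt0.
have /Bmin := feasible_line Es mu_neq0 (c_hat L M Sigma).
rewrite -/N -subr_le0 gap pmulr_rle0 ?mulr_gt0 // => sq_le0.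
have /eqP : (c - c_hat L M Sigma) ^+ 2 = 0.
  by apply/eqP; rewrite eq_le sq_le0 sqr_ge0.
by rewrite sqrf_eq0 subr_eq0 => /eqP ->.
Qed.
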